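(* Let $R$ be a Noetherian ring and $M$ a finitely generated $R$-module of (finite) dimension $d$. Let $\mathcal{F}: 0\subset M_0\subset M_1\subset\cdots\subset M_{d-1}\subset M_d=M$ be a filtration of $M$ by submodules (inclusions not necessarily strict), and set $M_{-1}=0$. The following conditions are equivalent: (a) $\operatorname{Ass}(M_i/M_{i-1})=\operatorname{Ass}^i(M)$ for all $i=0,\dots,d$; (b) $\mathcal{F}$ is the dimension filtration of $M$.
   Context: $\operatorname{Ass}^i(M)=\{P\in\operatorname{Ass}(M): \dim R/P=i\}$. The dimension filtration of $M$ is $0\subset D_0(M)\subset D_1(M)\subset\cdots\subset D_d(M)=M$, where $D_i(M)$ is the largest submodule of $M$ with $\dim D_i(M)\le i$, for $i=0,\dots,d$. *)

(* Defs.v *)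
From HB Require Import structures.
From mathcomp Require Import all_boot all_algebra.
From mathcomp Require Import ring_quotient.

Set Implicit Arguments.
Unset Strict Implicit.
Unset Printing Implicit Defensive.

Import GRing.Theory.
Local Open Scope ring_scope.
Local Open Scope quotient_scope.

(* Ideals and submodules are boolean predicates, as everywhere in MathComp;     *)
(* classically this is no restriction.                                          *)

Section Modules.
Variables (R : comNzRingType) (M : lmodType R).

Definition submod (N : submodClosed M) : Type := {x : M | x \in N}.
HB.instance Definition _ (N : submodClosed M) :=
  SubChoice.copy (submod N) {x : M | x \in N}.
HB.instance Definition _ (N : submodClosed M) :=
  [SubChoice_isSubLmodule of submod N by <:].

Definition zero_submod : {pred M} := [pred x | x == 0].
Lemma zero_submod_closed : submod_closed zero_submod.
Proof. by split=> [|a u v /eqP-> /eqP->]; rewrite inE ?scaler0 ?addr0. Qed.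
HB.instance Definition _ :=
  GRing.isSubmodClosed.Build R M zero_submod zero_submod_closed.

(* The submodule L of M seen inside N, that is, N `&` L as a submodule of N.    *)
Definition sub_in (N L : submodClosed M) : {pred submod N} :=
  [pred x | val x \in L].
Arguments sub_in : clear implicits.
Lemma sub_in_closed (N L : submodClosed M) : submod_closed (sub_in N L).
Proof.
split=> [|a u v uL vL]; first by rewrite inE raddf0 rpred0.
by rewrite inE linearP rpredD ?rpredZ.
Qed.
HB.instance Definition _ (N L : submodClosed M) :=
  GRing.isSubmodClosed.Build R (submod N) (sub_in N L) (sub_in_closed N L).

End Modules.
Arguments sub_in {R M} N L.

Section QuotientModule.
Variables (R : comNzRingType) (M : lmodType R) (N : submodClosed M).

(* The library only quotients additive groups, by a zmodClosed predicate, and   *)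
(* commutative rings; submodClosed does not inherit from zmodClosed.            *)
Definition subgroup_of : {pred M} := [pred x | x \in N].
Lemma subgroup_of_closed : zmod_closed subgroup_of.
Proof.
split=> [|x y Nx Ny]; first by rewrite inE rpred0.
by rewrite inE -scaleN1r rpredD ?rpredZ.
Qed.
HB.instance Definition _ :=
  GRing.isZmodClosed.Build M subgroup_of subgroup_of_closed.

Definition quotmod : Type := Quotient.quot subgroup_of.
HB.instance Definition _ := GRing.Zmodule.on quotmod.

Definition quotmod_pi (x : M) : quotmod := \pi_(Quotient.quot subgroup_of) x.
Definition quotmod_scale (a : R) (x : quotmod) : quotmod :=
  quotmod_pi (a *: repr (x : Quotient.quot subgroup_of)).

Lemma quotmod_scale_pi a x :
  quotmod_scale a (quotmod_pi x) = quotmod_pi (a *: x).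
Proof.
apply/eqP; rewrite /quotmod_scale /quotmod_pi -Quotient.idealrBE -scalerBr.
by rewrite inE rpredZ // -[_ \in N]/(_ \in subgroup_of) Quotient.idealrBE reprK.
Qed.

Lemma quotmod_piD x y : quotmod_pi (x + y) = quotmod_pi x + quotmod_pi y.
Proof. exact: (raddfD (\pi_(Quotient.quot subgroup_of))). Qed.

Lemma quotmod_piP (x : quotmod) : exists y, x = quotmod_pi y.
Proof. by exists (repr (x : Quotient.quot subgroup_of)); rewrite /quotmod_pi reprK. Qed.

Lemma quotmod_scaleA a b x :
  quotmod_scale a (quotmod_scale b x) = quotmod_scale (a * b) x.
Proof. by have [y ->] := quotmod_piP x; rewrite !quotmod_scale_pi scalerA. Qed.

Lemma quotmod_scale1 : left_id 1 quotmod_scale.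
Proof. by move=> x; have [y ->] := quotmod_piP x; rewrite quotmod_scale_pi scale1r. Qed.

Lemma quotmod_scaleDr : right_distributive quotmod_scale +%R.
Proof.
move=> a x y; have [[x' ->] [y' ->]] := (quotmod_piP x, quotmod_piP y).
by rewrite -quotmod_piD !quotmod_scale_pi scalerDr quotmod_piD.
Qed.

Lemma quotmod_scaleDl x : {morph quotmod_scale^~ x : a b / a + b}.
Proof.
move=> a b; have [y ->] := quotmod_piP x.
by rewrite !quotmod_scale_pi scalerDl quotmod_piD.
Qed.

HB.instance Definition _ := GRing.Zmodule_isLmodule.Build R quotmod
  quotmod_scaleA quotmod_scale1 quotmod_scaleDr quotmod_scaleDl.

Lemma quotmod_piZ a x : quotmod_pi (a *: x) = a *: quotmod_pi x.
Proof. by rewrite -quotmod_scale_pi. Qed.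

Lemma quotmod_pi_eq0 x : quotmod_pi x = 0 <-> x \in N.
Proof.
have -> : 0 = quotmod_pi 0 by rewrite /quotmod_pi raddf0.
have -> : (x \in N) = (quotmod_pi x == quotmod_pi 0).
  by rewrite -Quotient.idealrBE subr0.
by split=> /eqP.
Qed.

End QuotientModule.

(* N / L, intended for L contained in N; in general N / (N `&` L).              *)
Definition subquot (R : comNzRingType) (M : lmodType R) (N L : submodClosed M)
    : lmodType R :=
  quotmod (sub_in N L).

Section Finiteness.
Variable R : comNzRingType.

Definition fin_gen (M : lmodType R) : Prop :=
  exists s : seq M, forall x : M,
    exists c : 'I_(size s) -> R, x = \sum_(i < size s) c i *: s`_i.

Definition noetherian_module (M : lmodType R) : Prop :=
  forall N : submodClosed M, fin_gen (submod N).

End Finiteness.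

Definition noetherian_ring (R : comNzRingType) : Prop :=
  noetherian_module R^o.

Section KrullDimension.
Variable A : comNzRingType.

Definition strict_prime_chain (n : nat) (p : 'I_n.+1 -> prime_idealr A) : Prop :=
  forall i j : 'I_n.+1, (i < j)%N ->
    {subset p i <= p j} /\ ~ {subset p j <= p i}.

Definition krull_dim_le (n : nat) : Prop :=
  forall m (p : 'I_m.+1 -> prime_idealr A), strict_prime_chain p -> (m <= n)%N.

Definition krull_dim_eq (n : nat) : Prop :=
  (exists p : 'I_n.+1 -> prime_idealr A, strict_prime_chain p) /\
  krull_dim_le n.

End KrullDimension.

Section ModuleDimension.
Variables (R : comNzRingType) (M : lmodType R).

(* dim M is the Krull dimension of R / Ann M. The type idealr R contains only   *)
(* proper ideals, so is_ann I forces M to be nonzero; the zero module has       *)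
(* dimension -oo, hence dimension at most n for every n.                        *)
Definition is_ann (I : idealr R) : Prop :=
  forall r : R, r \in I <-> (forall x : M, r *: x = 0).

Definition module_dim_eq (n : nat) : Prop :=
  exists2 I : idealr R, is_ann I & krull_dim_eq {ideal_quot I} n.

Definition module_dim_le (n : nat) : Prop :=
  (forall x : M, x = 0) \/
  exists2 I : idealr R, is_ann I & krull_dim_le {ideal_quot I} n.

Definition Ass (P : prime_idealr R) : Prop :=
  exists x : M, forall r : R, r \in P <-> r *: x = 0.

Definition Ass_dim (i : nat) (P : prime_idealr R) : Prop :=
  Ass P /\ krull_dim_eq {ideal_quot P} i.

End ModuleDimension.

Section Filtrations.
Variables (R : comNzRingType) (M : lmodType R).

(* Filtrations M_0, ..., M_d are indexed by nat; only indices i <= d matter.    *)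
Definition is_filtration (d : nat) (F : nat -> submodClosed M) : Prop :=
  (forall i, (i < d)%N -> {subset F i <= F i.+1}) /\
  (forall x : M, x \in F d).

(* M_{i-1}, with M_{-1} = 0.                                                    *)
Definition prev_step (F : nat -> submodClosed M) (i : nat) : submodClosed M :=
  if i is j.+1 then F j else @zero_submod R M.

Definition largest_dim_le (i : nat) (D : submodClosed M) : Prop :=
  module_dim_le (submod D) i /\
  forall N : submodClosed M, module_dim_le (submod N) i -> {subset N <= D}.

Definition is_dimension_filtration (d : nat) (F : nat -> submodClosed M) : Prop :=
  forall i, (i <= d)%N -> largest_dim_le i (F i).

End Filtrations.

(* Main.v *)
Require Import Defs.
From HB Require Import structures.
From mathcomp Require Import all_boot all_algebra.
From mathcomp Require Import ring_quotient.
From mathcomp Require Import boolp.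

(* A dimension filtration gives the associated primes by hand: if                *)
(* P = (D_{i-1} : x) with x in D_i, then dim R/P < i would make D_{i-1} + Rx     *)
(* too large, so some a outside P kills D_{i-1} and P = Ann (a x).               *)
(* Conversely, a colon ideal (L : r x) maximal among those avoiding a            *)
(* multiplicative set is prime. Hence every prime over Ann N contains an         *)
(* associated prime of the finitely generated module N, so dim F_i <= i; and an  *)
(* element x of N outside F_i, taken in F_j with j minimal, yields an associated *)
(* prime of F_j / F_{j-1} over Ann N, of coheight j > i.                         *)

Set Implicit Arguments.
Unset Strict Implicit.
Unset Printing Implicit Defensive.

Import GRing.Theory.
Local Open Scope ring_scope.
Local Open Scope quotient_scope.

(** Every dimension is read off chains of primes over an annihilator ([dim_lt]), so comparing
    dimensions amounts to comparing annihilators with primes. For a dimension filtration, a prime P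
    = (F_{i-1} : x) with x in F_i has coheight at most i because it contains Ann F_i. It has
    coheight at least i by maximality of F_{i-1} ([dim_lt_adjoin]), and is then an associated prime
    of M itself ([prime_annih_Ass]). Conversely, if P = Ann x has coheight i, then R x has dimension
    i and so lies in F_i. In the other direction, [exists_prime_colon] supplies the associated
    primes. They bound dim F_i from above ([dim_lt_annih_Ass], [dim_lt_step]), and they show that a
    submodule reaching outside F_i has dimension greater than i ([step_largest]). *)

Lemma exists_idealr (R : comNzRingType) (p : R -> Prop) :
  p 0 -> ~ p 1 -> (forall a u v, p u -> p v -> p (a * u + v)) ->
  exists I : idealr R, forall r, r \in I <-> p r.
Proof.
move=> p0 p1 pD; pose S : {pred R} := [pred r | `[< p r >]].
have SP r : r \in S <-> p r by rewrite inE; split=> /asboolP.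
have Sid : idealr_closed S.
  split; [exact/SP | exact/negP/SP |].
  by move=> a u v /SP pu /SP pv; apply/SP/pD.
pose I : idealr R := HB.pack S (isIdealr.Build R S Sid).
by exists I.
Qed.

Lemma exists_prime_idealr (R : comNzRingType) (p : R -> Prop) :
  p 0 -> ~ p 1 -> (forall a u v, p u -> p v -> p (a * u + v)) ->
  (forall u v, p (u * v) -> p u \/ p v) ->
  exists P : prime_idealr R, forall r, r \in P <-> p r.
Proof.
move=> p0 p1 pD pM; pose S : {pred R} := [pred r | `[< p r >]].
have SP r : r \in S <-> p r by rewrite inE; split=> /asboolP.
have Sid : idealr_closed S.
  split; [exact/SP | exact/negP/SP |].
  by move=> a u v /SP pu /SP pv; apply/SP/pD.
have Spr : prime_idealr_closed S.
  by move=> u v /SP /pM [] /SP ->; rewrite ?orbT.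
pose P : prime_idealr R :=
  HB.pack S (isIdealr.Build R S Sid) (isPrimeIdealrClosed.Build R S Spr).
by exists P.
Qed.

(** * Colon ideals, annihilators and finite spans *)

Section Submodules.
Variables (R : comNzRingType) (M : lmodType R).
Implicit Types (L N : submodClosed M) (x : M).

(** A submodule of [R^o] rather than an [idealr], since it is all of R when x lies in L. *)
Definition colon L x : {pred R^o} := [pred a | a *: x \in L].
Lemma colon_closed L x : submod_closed (colon L x).
Proof.
split=> [|a u v uL vL]; first by rewrite inE scale0r rpred0.
by rewrite inE scalerDl -[a *: u]/(a * u) -scalerA rpredD // rpredZ.
Qed.
HB.instance Definition _ L x :=
  GRing.isSubmodClosed.Build R R^o (colon L x) (colon_closed L x).

(** The submodule L + R x. *)
Definition adjoin L x : {pred M} := [pred y | `[< exists a, y - a *: x \in L >]].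
Lemma adjoin_closed L x : submod_closed (adjoin L x).
Proof.
split=> [|a u v /asboolP[b ub] /asboolP[c vc]].
  by rewrite inE; apply/asboolP; exists 0; rewrite scale0r subr0 rpred0.
rewrite inE; apply/asboolP; exists (a * b + c).
have -> : a *: u + v - (a * b + c) *: x = a *: (u - b *: x) + (v - c *: x).
  by rewrite scalerBr scalerDl scalerA opprD addrACA.
by rewrite rpredD ?rpredZ.
Qed.
HB.instance Definition _ L x :=
  GRing.isSubmodClosed.Build R M (adjoin L x) (adjoin_closed L x).

Lemma mem_adjoin L x : x \in adjoin L x.
Proof. by apply/asboolP; exists 1; rewrite scale1r subrr rpred0. Qed.

Definition annih N (r : R) : Prop := forall x, x \in N -> r *: x = 0.

Lemma annih_idealr N : (exists2 x, x \in N & x != 0) ->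
  exists I : idealr R, forall r, r \in I <-> annih N r.
Proof.
move=> [x Nx x0]; apply: exists_idealr => [y|ann1|a u v uN vN y Ny].
- by rewrite scale0r.
- by have := ann1 x Nx; rewrite scale1r => /eqP; apply/negP.
- by rewrite scalerDl -scalerA uN // vN // scaler0 addr0.
Qed.

(** The annihilator of the class of x is the colon ideal (L : x), so associated primes of the
    quotient can be handled by elements of M. *)
Lemma Ass_subquotP N L (P : prime_idealr R) :
  Ass (subquot N L) P <->
  exists2 x, x \in N & forall r, r \in P <-> r *: x \in L.
Proof.
split=> [[q qP]|[x Nx xP]].
  have [y yq] := quotmod_piP q; exists (val y); first exact: valP.
  by move=> r; rewrite qP yq -quotmod_piZ quotmod_pi_eq0 inE linearZ.
exists (quotmod_pi (sub_in N L) (Sub x Nx)) => r.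
by rewrite xP -quotmod_piZ quotmod_pi_eq0 inE linearZ.
Qed.

Fixpoint in_span (s : seq M) x : Prop :=
  if s is y :: t then exists a, in_span t (x - a *: y) else x = 0.

Lemma in_span_sum (s : seq M) (c : 'I_(size s) -> R) :
  in_span s (\sum_(i < size s) c i *: s`_i).
Proof.
elim: s c => [|y s IHs] c /=; first by rewrite big_ord0.
exists (c ord0); rewrite big_ord_recl /= addrC addKr.
exact: (IHs (fun i => c (lift ord0 i))).
Qed.

Lemma in_spanD (s : seq M) a x y :
  in_span s x -> in_span s y -> in_span s (a *: x + y).
Proof.
elim: s x y => [|z s IHs] x y /= => [-> ->|[b xs] [c ys]].
  by rewrite scaler0 addr0.
exists (a * b + c).
rewrite scalerDl -scalerA opprD addrACA -scalerBr.
exact: IHs.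
Qed.

Lemma in_span_sub N (s : seq M) x :
  {in s, forall y, y \in N} -> in_span s x -> x \in N.
Proof.
elim: s x => [|y s IHs] x sN /= => [->|[a /IHs]]; first exact: rpred0.
have Ny : y \in N by apply: sN; rewrite mem_head.
move=> xN; rewrite -(subrK (a *: y) x) rpredD ?rpredZ //.
by apply: xN => z sz; apply: sN; rewrite inE sz orbT.
Qed.

End Submodules.

Lemma in_span_map (R : comNzRingType) (M M' : lmodType R)
    (f : {linear M -> M'}) (s : seq M) (x : M) :
  in_span s x -> in_span (map f s) (f x).
Proof.
elim: s x => [|y s IHs] x /= => [->|[a /IHs]]; first exact: linear0.
by exists a; rewrite -linearZ -linearB.
Qed.

Lemma fin_gen_submod (R : comNzRingType) (M : lmodType R) (N : submodClosed M) :
  fin_gen (submod N) ->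
  exists2 s : seq M, {in s, forall y, y \in N} & {in N, forall x, in_span s x}.
Proof.
case=> s sN; exists (map val s) => [y /mapP[z _ ->]|x Nx]; first exact: valP.
have [c xE] := sN (Sub x Nx).
have := in_span_sum c; rewrite -xE => /(in_span_map val).
by [].
Qed.

(** * Consequences of the Noetherian hypothesis *)

Section Noetherian.
Variable R : comNzRingType.
Hypothesis noethR : noetherian_ring R.

(** Without a maximal member, choice yields a strictly increasing sequence of ideals. Its union is
    finitely generated, the generators already lie in one term, and the sequence stops there. *)
Lemma noetherian_max (T : Type) (I : T -> submodClosed R^o) (C : T -> Prop) t0 :
  C t0 -> exists t, C t /\
    forall t', C t' -> {subset I t <= I t'} -> {subset I t' <= I t}.
Proof.
move=> Ct0; apply: contrapT => nomax.
have /choice[f fP] (t : T) : exists t', C t ->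
    [/\ C t', {subset I t <= I t'} & ~ {subset I t' <= I t}].
  have [Ct|nCt] := pselect (C t); last by exists t.
  apply: contrapT => not'; apply: nomax; exists t; split=> // t' Ct' tt'.
  by apply: contrapT => t't; apply: not'; exists t'.
pose u n := iter n f t0.
have Cu n : C (u n) by elim: n => //= n /fP[].
have uS n : {subset I (u n) <= I (u n.+1)} by have [] := fP _ (Cu n).
have uSS m n : (m <= n)%N -> {subset I (u m) <= I (u n)}.
  elim: n => [|n IHn]; first by rewrite leqn0 => /eqP->.
  by rewrite leq_eqVlt => /predU1P[-> //|/IHn mn] x /mn /uS.
pose U : {pred R^o} := [pred a | `[< exists n, a \in I (u n) >]].
have Ucl : submod_closed U.
  split=> [|a x y /asboolP[m xm] /asboolP[n yn]]; rewrite inE; apply/asboolP.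
    by exists 0%N; rewrite rpred0.
  exists (maxn m n); rewrite rpredD ?rpredZ //.
    by apply: uSS xm; exact: leq_maxl.
  by apply: uSS yn; exact: leq_maxr.
pose V : submodClosed R^o := HB.pack U (GRing.isSubmodClosed.Build R R^o U Ucl).
have [s sV Vs] := fin_gen_submod (noethR V).
have [n sn] : exists n, {in s, forall y, y \in I (u n)}.
  elim: s sV {Vs} => [|y s IHs] sV; first by exists 0%N.
  have [|n sn] := IHs; first by move=> z sz; apply: sV; rewrite inE sz orbT.
  have /asboolP[m ym] : y \in V by apply: sV; rewrite mem_head.
  exists (maxn m n) => z; rewrite inE => /predU1P[->|/sn zn].
    by apply: uSS ym; exact: leq_maxl.
  by apply: uSS zn; exact: leq_maxr.
have [_ _] := fP _ (Cu n); apply=> x xn; apply: (in_span_sub sn).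
by apply: Vs; apply/asboolP; exists n.+1.
Qed.

(** Take I = (L : r x) maximal among those avoiding S, and let a b lie in I. If (L : a r x) avoids
    S, it equals I and contains b. Otherwise it contains some s in S; then (L : s r x) still avoids
    S, equals I, and contains a. *)
Lemma exists_prime_colon (M : lmodType R) (L : submodClosed M) (x : M)
    (S : R -> Prop) :
  S 1 -> (forall a b, S a -> S b -> S (a * b)) ->
  (forall s, S s -> s *: x \notin L) ->
  exists r (P : prime_idealr R), (forall a, a \in P <-> a *: (r *: x) \in L) /\
    forall s, S s -> s \notin P.
Proof.
move=> S1 SM Sx; pose C r := forall s, S s -> s *: (r *: x) \notin L.
have C1 : C 1 by move=> s Ss; rewrite scale1r Sx.
have [r [Cr rmax]] := noetherian_max (fun r => colon L (r *: x)) C1.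
suff [P PE] : exists P : prime_idealr R, forall a, a \in P <-> a *: (r *: x) \in L.
  by exists r, P; split=> // s Ss; apply/negP => /PE; apply/negP/Cr.
apply: exists_prime_idealr.
- by rewrite scale0r rpred0.
- by apply/negP/Cr.
- by move=> a u v uL vL; rewrite scalerDl -scalerA rpredD // rpredZ.
move=> a b abL; apply: contrapT => /not_orP[aL bL].
have swap c d : c *: ((d * r) *: x) = d *: (c *: (r *: x)).
  by rewrite !scalerA mulrCA mulrA.
have [Car|] := pselect (C (a * r)).
  apply: bL; apply: (rmax _ Car) => [c|]; rewrite !inE swap.
    by move/rpredZ; apply.
  by rewrite scalerA.
move=> /existsNP[s /not_implyP[Ss /negP/negPn sL]]; apply: aL.
have Csr : C (s * r).
  by move=> t St; rewrite swap scalerA mulrC; apply/Cr/SM.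
apply: (rmax _ Csr) => [c|]; rewrite !inE swap.
  by move/rpredZ; apply.
by move: sL; rewrite -scalerA.
Qed.

(** The part of N inside a finite span is finitely generated, by induction on the spanning list. *)
Lemma in_span_submod_fg (M : lmodType R) (s : seq M) (N : submodClosed M) :
  exists2 t : seq M, {in t, forall y, y \in N} &
    forall x, x \in N -> in_span s x -> in_span t x.
Proof.
elim: s => [|m s [t tN tspan]]; first by exists [::].
(* [U] is the ideal of coefficients of [m] occurring in elements of N. Lifting its generators to N
   and adding generators of the part of N spanned by [s] suffices. *)
pose U : {pred R^o} :=
  [pred a | `[< exists2 y, y \in N & in_span s (y - a *: m) >]].
have Ucl : submod_closed U.
  split=> [|a b c /asboolP[y Ny ys] /asboolP[z Nz zs]]; rewrite inE; apply/asboolP.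
    exists 0; first exact: rpred0.
    by rewrite scale0r subrr; elim: (s) => //= w s' IH; exists 0; rewrite scale0r subr0.
  exists (a *: y + z); first by rewrite rpredD ?rpredZ.
  rewrite scalerDl -[a *: b]/(a * b) -scalerA opprD addrACA -scalerBr.
  exact: in_spanD.
pose V : submodClosed R^o := HB.pack U (GRing.isSubmodClosed.Build R R^o U Ucl).
have [l lV Vl] := fin_gen_submod (noethR V).
have {}Vl a : a \in U -> in_span l a by exact: Vl.
suff [t' t'N t'span] : exists2 t' : seq M, {in t', forall y, y \in N} &
    forall a x, x \in N -> in_span l a -> in_span s (x - a *: m) -> in_span t' x.
  exists t' => // x Nx [a xa]; apply: (t'span a) => //.
  by apply: Vl; apply/asboolP; exists x.
have lU : {in l, forall b, b \in U} by exact: lV.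
elim: l lU {lV Vl} => [|b l IHl] lU.
  exists t => // a x Nx /= ->; rewrite scale0r subr0; exact: tspan.
have [|t' t'N t'span] := IHl; first by move=> z zl; apply: lU; rewrite inE zl orbT.
have /asboolP[y Ny yb] : b \in U by apply: lU; rewrite mem_head.
exists (y :: t') => [z|a x Nx /= [c ac] xa].
  by rewrite inE => /predU1P[->|/t'N].
exists c; apply: t'span ac _; first by rewrite -scaleNr rpredD ?rpredZ.
have -> : x - c *: y - (a - c *: b) *: m = - c *: (y - b *: m) + (x - a *: m).
  rewrite scalerBl -[c *: b]/(c * b) scaleNr scalerBr !opprB scalerA.
  by rewrite addrACA [RHS]addrACA [X in X + _ = _]addrC.
exact: in_spanD.
Qed.
End Noetherian.

(** * Dimension through chains of primes *)

Section Dimension.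
Variable R : comNzRingType.
Implicit Types (a b : R -> Prop) (n : nat) (P : prime_idealr R).

(* The strict bound makes sense for n = 0, where it says that no prime contains  *)
(* a; this is what the term M_{-1} = 0 satisfies.                                *)
Definition dim_lt a n : Prop :=
  forall m (p : 'I_m.+1 -> prime_idealr R),
    strict_prime_chain p -> (forall r, a r -> r \in p ord0) -> (m < n)%N.

Lemma dim_lt_sub a b n : (forall r, a r -> b r) -> dim_lt a n -> dim_lt b n.
Proof. by move=> ab an m p pch bp; apply: (an m p) => // r /ab /bp. Qed.

Lemma dim_lt_leq a m n : (m <= n)%N -> dim_lt a m -> dim_lt a n.
Proof. by move=> mn am k p pch /(am _ _ pch) /leq_trans; apply. Qed.

Lemma quot_piK (I : idealr R) (x : {ideal_quot I}) : \pi_{ideal_quot I} (repr x) = x.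
Proof. exact: reprK. Qed.

Lemma quot_pi_eq (I : idealr R) (r s : R) :
  \pi_{ideal_quot I} r = \pi_{ideal_quot I} s -> r - s \in I.
Proof. by move/eqP; rewrite -Quotient.idealrBE. Qed.

Lemma quot_pi0 (I : idealr R) (r : R) : r \in I -> \pi_{ideal_quot I} r = 0.
Proof.
move=> Ir; have -> : 0 = \pi_{ideal_quot I} 0 by rewrite raddf0.
by apply/eqP; rewrite -Quotient.idealrBE subr0.
Qed.

Lemma prime_comap (I : idealr R) (Q : prime_idealr {ideal_quot I}) :
  exists P, forall r, r \in P <-> \pi_{ideal_quot I} r \in Q.
Proof.
apply: exists_prime_idealr => [||a u v|u v].
- by rewrite rmorph0 idealr0.
- by rewrite rmorph1 idealr1.
- by move=> uQ vQ; rewrite rmorphD rmorphM rpredD // idealMr.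
- by rewrite rmorphM prime_idealrM => /orP.
Qed.

Lemma prime_map (I : idealr R) P : {subset I <= P} ->
  exists Q : prime_idealr {ideal_quot I},
    forall r, \pi_{ideal_quot I} r \in Q <-> r \in P.
Proof.
move=> IP.
have piP r s : \pi_{ideal_quot I} r = \pi_{ideal_quot I} s -> s \in P -> r \in P.
  by move=> /quot_pi_eq /IP rs sP; rewrite -(subrK s r) rpredD.
pose q (x : {ideal_quot I}) := repr x \in P.
have qE r : q (\pi_{ideal_quot I} r) <-> r \in P.
  by split; apply: piP; rewrite quot_piK.
have [Q QE] : exists Q : prime_idealr {ideal_quot I}, forall x, x \in Q <-> q x.
  apply: exists_prime_idealr => [||x y z|x y].
  - by rewrite -(rmorph0 (\pi_{ideal_quot I})); apply/qE; exact: idealr0.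
  - by rewrite -(rmorph1 (\pi_{ideal_quot I})) => /qE; rewrite idealr1.
  - rewrite -[x]quot_piK -[y]quot_piK -[z]quot_piK => /qE yP /qE zP.
    by rewrite -rmorphM -rmorphD; apply/qE; rewrite rpredD // idealMr.
  - rewrite -[x]quot_piK -[y]quot_piK -rmorphM => /qE.
    by rewrite prime_idealrM => /orP[] /qE; [left|right].
by exists Q => r; rewrite QE.
Qed.

(** Primes of R/I correspond to primes of R over I. In an increasing chain only the first prime has
    to be tested for containing I. *)
Lemma krull_quotP (I : idealr R) n :
  (forall m (q : 'I_m.+1 -> prime_idealr {ideal_quot I}),
     strict_prime_chain q -> (m < n)%N)
  <-> dim_lt (fun r => r \in I) n.
Proof.
split=> [lt_n m p pch Ip|lt_n m q qch].
  have Isub i : {subset I <= p i}.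
    move=> r /Ip rp; have [->//|i0] := eqVneq i ord0.
    by have [|+ _] := pch ord0 i; [rewrite lt0n|apply].
  have [q qE] := choice (fun i => prime_map (Isub i)).
  apply: (lt_n m q) => i j /pch[pij pji]; split=> [x|qji].
    by rewrite -[x]quot_piK => /qE /pij /qE.
  by apply: pji => r /qE /qji /qE.
have [p pE] := choice (fun i => prime_comap (q i)).
apply: (lt_n m p) => [i j /qch[qij qji]|r Ir]; last first.
  by apply/pE; rewrite quot_pi0 // idealr0.
split=> [r /pE /qij /pE //|pji]; apply: qji => x.
by rewrite -[x]quot_piK => /pE /pji /pE.
Qed.

Lemma krull_dim_quot_eqP P n : krull_dim_eq {ideal_quot P} n <->
  dim_lt (fun r => r \in P) n.+1 /\ ~ dim_lt (fun r => r \in P) n.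
Proof.
split=> [[[q qch] le_n]|[/krull_quotP lt_n not_lt]].
  split; first exact/krull_quotP.
  by move=> /krull_quotP/(_ n q qch); rewrite ltnn.
split=> //; apply: contrapT => noq; apply: not_lt; apply/krull_quotP => m q qch.
have := lt_n m q qch; rewrite ltnS leq_eqVlt => /predU1P[mn|//].
by case: noq; rewrite -mn; exists q.
Qed.

(** The zero module fits in: its annihilator contains 1, so no prime lies over it and the bound is
    vacuous. *)
Lemma dim_submodP (M : lmodType R) (N : submodClosed M) n :
  module_dim_le (submod N) n <-> dim_lt (annih N) n.+1.
Proof.
have annE r : annih N r <-> forall x : submod N, r *: x = 0.
  split=> [rN x|rN x Nx]; first by apply: val_inj; exact: rN (valP x).
  by exact: (congr1 val (rN (exist _ x Nx))).
split=> [[N0 m p pch pann|[I IE le_n]]|lt_n].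
- have : 1 \in p ord0 by apply/pann/annE => x; rewrite (N0 (1 *: x)).
  by rewrite idealr1.
- by apply: dim_lt_sub ((krull_quotP I n.+1).1 le_n) => r /IE /annE.
have [nz|z] := pselect (exists2 x, x \in N & x != 0); last first.
  left=> x; apply/eqP/negPn/negP => x0; apply: z; exists (val x); first exact: valP.
  by apply: contra x0 => /eqP x0; apply/eqP/val_inj; rewrite x0 linear0.
right; have [I IE] := annih_idealr nz; exists I; first by move=> r; rewrite IE annE.
by apply: (krull_quotP I n.+1).2; apply: dim_lt_sub lt_n => r /IE.
Qed.

End Dimension.

(** * Associated primes and the two implications *)

Section DimensionFiltration.
Variables (R : comNzRingType) (M : lmodType R).
Implicit Types (L N : submodClosed M) (P : prime_idealr R).

Lemma mem_zero_submod (x : M) : x \in @zero_submod R M <-> x = 0.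
Proof. by split=> /eqP. Qed.

Lemma colon_scale_notin P L (x : M) a :
  (forall r, r \in P <-> r *: x \in L) -> a \notin P ->
  forall r, r \in P <-> r *: (a *: x) \in L.
Proof.
by move=> xP aP r; rewrite scalerA -xP prime_idealrM (negPf aP) orbF.
Qed.

Lemma dim_lt_annih_mem P L n (x : M) : x \in L ->
  (forall r, r *: x = 0 -> r \in P) -> dim_lt (annih L) n -> dim_lt (fun r => r \in P) n.
Proof. by move=> Lx xP; apply: dim_lt_sub => r rL; apply/xP/rL. Qed.

(** The dimension gap gives a in Ann L outside P. Since P x lies in L, a x is killed by P, and by
    nothing more because P is prime. *)
Lemma prime_annih_Ass P L n (x : M) :
  (forall r, r \in P <-> r *: x \in L) ->
  dim_lt (annih L) n -> ~ dim_lt (fun r => r \in P) n -> Ass M P.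
Proof.
move=> xP Ln Pn.
have [a aL aP] : exists2 a, annih L a & a \notin P.
  apply: contrapT => noa; apply: Pn; apply: dim_lt_sub Ln => r rL.
  by apply: contrapT => /negP rP; apply: noa; exists r.
exists (a *: x) => r; split=> [/xP /aL|rax]; first by rewrite !scalerA mulrC.
by apply/(colon_scale_notin xP aP); rewrite rax rpred0.
Qed.

(** The product of P and Ann L kills L + R x, so a prime over Ann (L + R x) contains P or Ann L. *)
Lemma dim_lt_adjoin P L n (x : M) :
  (forall r, r \in P <-> r *: x \in L) ->
  dim_lt (annih L) n -> dim_lt (fun r => r \in P) n ->
  dim_lt (annih (adjoin L x)) n.
Proof.
move=> xP Ln Pn m p pch pann.
have [Pp|] := pselect (forall r, r \in P -> r \in p ord0); first exact: Pn pch Pp.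
move=> /existsNP[r /not_implyP[rP /negP rp]]; apply: (Ln _ _ pch) => s sL.
have : s * r \in p ord0.
  apply: pann => y /asboolP[a ya]; rewrite -(subrK (a *: x) y) scalerDr.
  rewrite -scalerA [s *: _]sL ?rpredZ // add0r -scalerA sL //.
  by rewrite scalerA mulrC -scalerA rpredZ // -xP.
by rewrite prime_idealrM (negPf rp) orbF.
Qed.

Lemma dim_lt_annih_Ass N n : noetherian_ring R -> fin_gen M ->
  (forall P (x : M), x \in N -> (forall r, r \in P <-> r *: x = 0) ->
     dim_lt (fun r => r \in P) n) ->
  dim_lt (annih N) n.
Proof.
move=> noethR [s sM] Pn m p pch pann.
have [t tN tspan] := in_span_submod_fg noethR s N.
(* Some generator y of N has Ann y inside [p ord0]. Otherwise a product of elements outside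
   [p ord0], one per generator, would kill N. *)
have [y [ty yp]] : exists y, y \in t /\ forall r, r \notin p ord0 -> r *: y != 0.
  apply: contrapT => noy.
  suff [r rp rt] : exists2 r, r \notin p ord0 & {in t, forall y, r *: y = 0}.
    case/negP: rp; apply: pann => x Nx.
    have [c xE] := sM x; have xt : in_span t x.
      by apply: tspan => //; rewrite xE; exact: in_span_sum.
    elim: (t) x xt rt {Nx xE} => [|y u IHu] x /= => [-> _|[a /IHu{}IHu] ru].
      by rewrite scaler0.
    rewrite -(subrK (a *: y) x) scalerDr IHu => [|z uz]; last first.
      by rewrite ru ?inE ?uz ?orbT.
    by rewrite scalerA mulrC -scalerA ru ?mem_head // scaler0 addr0.
  elim: (t) noy => [|y u IHu] noy; first by exists 1 => //; rewrite idealr1.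
  have [|r rp ru] := IHu.
    by case=> z [zu zp]; apply: noy; exists z; rewrite inE zu orbT.
  have [q qp qy] : exists2 q, q \notin p ord0 & q *: y = 0.
    apply: contrapT => noq; apply: noy; exists y; rewrite mem_head; split=> // q qp.
    by apply/eqP => qy; apply: noq; exists q.
  exists (r * q); first by rewrite prime_idealrM negb_or rp.
  move=> z; rewrite inE -scalerA => /predU1P[->|/ru rz]; first by rewrite qy scaler0.
  by rewrite scalerA mulrC -scalerA rz scaler0.
(* With S the complement of [p ord0], this gives a prime Ann (r y) inside [p ord0], over which the
   given chain also lies. *)
have [] := exists_prime_colon (x := y) (L := @zero_submod R M) noethR
  (S := fun r => r \notin p ord0).
- by rewrite idealr1.
- by move=> a b ap bp; rewrite prime_idealrM negb_or ap.
- by move=> r /yp; rewrite inE.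
move=> r [P [PE Pp]]; apply: (Pn P (r *: y)) pch _ => [|a|a aP].
- by rewrite rpredZ // tN.
- by rewrite PE inE; split=> /eqP.
- by apply: contraTT aP => /Pp.
Qed.

Section Steps.
Variables (d : nat) (F : nat -> submodClosed M).

Lemma dimension_filtration_Ass i P :
  is_dimension_filtration d F -> (i <= d)%N ->
  Ass (subquot (F i) (prev_step F i)) P <-> Ass_dim M i P.
Proof.
move=> dimF le_i_d.
have Fi : dim_lt (annih (F i)) i.+1 by apply/dim_submodP; case: (dimF i le_i_d).
have Li : dim_lt (annih (prev_step F i)) i.
  case: i le_i_d {Fi} => [|i] le_i_d /=; last first.
    by apply/dim_submodP; case: (dimF i (ltnW le_i_d)).
  move=> m p _ /(_ 1); rewrite idealr1 => p1.
  by apply: p1 => x /mem_zero_submod->; rewrite scaler0.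
rewrite Ass_subquotP; split=> [[x Fx xP]|[[x xP] /krull_dim_quot_eqP[Pi1 Pi]]].
  have Pi1 : dim_lt (fun r => r \in P) i.+1.
    apply: dim_lt_annih_mem Fx _ Fi => r rx.
    by rewrite xP rx rpred0.
  have Pi : ~ dim_lt (fun r => r \in P) i.
    (* For i = 0 the one-term chain P is already too long. For i > 0, F_{i-1} + R x has dimension
       less than i, so maximality puts x in F_{i-1}, making P the unit ideal. *)
    move=> Pi; have := dim_lt_adjoin xP Li Pi.
    suff xL : ~ x \in prev_step F i.
      case: i le_i_d {Fi Fx Pi1} Li Pi xP xL => [|i] le_i_d _ Pi xP xL.
        move=> _; suff: (0 < 0)%N by [].
        by apply: (Pi 0%N (fun=> P)) => // j k; rewrite !ord1.
      move=> /dim_submodP; have [_ max_i] := dimF i (ltnW le_i_d).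
      by move=> /max_i sub; apply: xL (sub x (mem_adjoin _ x)).
    by move=> Lx; have := idealr1 P; rewrite (introT idP _ : 1 \in P) // xP scale1r.
  by split; [exact: prime_annih_Ass xP Li Pi | exact/krull_dim_quot_eqP].
(* If r x lies in F_{i-1} with r outside P, then Ann (r x) = P contains Ann F_{i-1}, so P has
   coheight less than i. *)
exists x => [|r]; last split=> [/xP->|rx]; first 1 last.
- exact: rpred0.
- apply: contrapT => /negP rP; apply: Pi.
  apply: dim_lt_annih_mem rx _ Li => a; rewrite scalerA => /xP.
  by rewrite prime_idealrM (negPf rP) orbF.
have [_ max_i] := dimF i le_i_d.
apply: (max_i (adjoin (@zero_submod R M) x) _ _ (mem_adjoin _ x)).
apply/dim_submodP; apply: dim_lt_sub Pi1 => r /xP rx y.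
case/asboolP=> a /mem_zero_submod/subr0_eq->.
by rewrite scalerA mulrC -scalerA rx scaler0.
Qed.

Hypotheses (noethR : noetherian_ring R) (fgM : fin_gen M).
Hypothesis filtF : is_filtration d F.
Hypothesis AssF : forall i, (i <= d)%N -> forall P,
  Ass (subquot (F i) (prev_step F i)) P <-> Ass_dim M i P.

Lemma Ass_dim_step i P x : (i <= d)%N -> x \in F i ->
  (forall r, r \in P <-> r *: x \in prev_step F i) ->
  krull_dim_eq {ideal_quot P} i.
Proof.
move=> le_i_d Fx xP; have /(AssF le_i_d)[//] : Ass (subquot (F i) (prev_step F i)) P.
by apply/Ass_subquotP; exists x.
Qed.

Lemma filtration_sub i j : (i <= j <= d)%N -> {subset F i <= F j}.
Proof.
elim: j => [|j IHj] /andP[le_i_j le_j_d]; first by move: le_i_j; rewrite leqn0 => /eqP->.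
move: le_i_j; rewrite leq_eqVlt => /predU1P[->//|le_i_j] x Fx.
by apply: filtF.1 => //; apply: IHj; rewrite // -ltnS le_i_j ltnW.
Qed.

(** It suffices to bound the coheight of P = Ann x for x in F_i. Take j least such that r x lies in
    F_j for some r outside P. Minimality gives P = (F_{j-1} : r x), so P has coheight j, and j is at
    most i. *)
Lemma dim_lt_step i : (i <= d)%N -> dim_lt (annih (F i)) i.+1.
Proof.
move=> le_i_d; apply: dim_lt_annih_Ass => // P x Fx xP.
pose meets j := `[< exists2 r, r \notin P & r *: x \in F j >].
have meets_i : meets i by apply/asboolP; exists 1; rewrite ?idealr1 ?scale1r.
have [j /asboolP[r rP Fj] jmin] := ex_minnP (ex_intro _ i meets_i).
have le_j_i := jmin i meets_i.
suff /(Ass_dim_step (leq_trans le_j_i le_i_d) Fj) /krull_dim_quot_eqP[+ _] :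
    forall s, s \in P <-> s *: (r *: x) \in prev_step F j.
  exact: dim_lt_leq.
move=> s; split=> [/xP sx|].
  by rewrite scalerA mulrC -scalerA sx scaler0 rpred0.
case: j jmin {Fj le_j_i} => [|j] jmin /=; rewrite scalerA => srF.
  by move/mem_zero_submod/xP: srF; rewrite prime_idealrM (negPf rP) orbF.
apply: contrapT => /negP sP; suff /jmin : meets j by rewrite ltnn.
by apply/asboolP; exists (s * r); rewrite // prime_idealrM negb_or sP.
Qed.

Lemma step_largest i N :
  (i <= d)%N -> dim_lt (annih N) i.+1 -> {subset N <= F i}.
Proof.
move=> le_i_d Ni x0 Nx0; apply: contrapT => Fx0.
pose escapes j := `[< exists2 x, x \in N & x \in F j /\ ~ x \in F i >].
have escapes_d : escapes d by apply/asboolP; exists x0 => //; split=> //; exact: filtF.2.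
have [j /asboolP[x Nx [Fjx Fix]] jmin] := ex_minnP (ex_intro _ d escapes_d).
have le_j_d := jmin d escapes_d.
have lt_i_j : (i < j)%N.
  by rewrite ltnNge; apply/negP => le_j_i; apply/Fix/filtration_sub/Fjx/andP.
case: j jmin lt_i_j le_j_d Fjx => // k jmin lt_i_k le_k_d Fkx.
have Fkx' : x \notin F k.
  apply/negP => xk; suff /jmin : escapes k by rewrite ltnn.
  by apply/asboolP; exists x.
(* Avoiding S = {1} only asks the colon ideal to be proper. The resulting P contains Ann N, yet has
   coheight k + 1 > i. *)
have [||s|r [P [PE _]]] := exists_prime_colon (L := F k) (x := x) noethR (S := eq 1).
- by [].
- by move=> a b <- <-; rewrite mulr1.
- by move=> <-; rewrite scale1r.
have rFk : r *: x \in F k.+1 by rewrite rpredZ.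
have /krull_dim_quot_eqP[_] := Ass_dim_step le_k_d rFk PE.
apply; apply: dim_lt_leq lt_i_k _; apply: dim_lt_sub Ni => a aN.
by apply/PE; rewrite aN ?rpred0 // rpredZ.
Qed.

End Steps.
End DimensionFiltration.

Theorem proposition1p1 (R : comNzRingType) (M : lmodType R) (d : nat)
    (F : nat -> submodClosed M) :
  noetherian_ring R -> fin_gen M -> module_dim_eq M d -> is_filtration d F ->
  (forall i : nat, (i <= d)%N -> forall P : prime_idealr R,
     Ass (subquot (F i) (prev_step F i)) P <-> Ass_dim M i P)
  <-> is_dimension_filtration d F.
Proof.
move=> noethR fgM _ filtF; split=> [AssF i le_i_d|dimF i le_i_d P]; last first.
  exact: dimension_filtration_Ass dimF le_i_d.
split; first by apply/dim_submodP; exact: (dim_lt_step noethR fgM AssF).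
by move=> N /dim_submodP Ni; exact: (step_largest noethR filtF AssF le_i_d Ni).
Qed.
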